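(* Let $A$ be a finite non-empty alphabet. Every non-periodic standard episturmian word $s\in A^\omega$ is in $\mathcal P$.
   Context: $A^\omega$ is the set of one-sided infinite words over $A$. A factor $u$ of $s$ is left special if there are two different letters $x,y$ such that $xu$ and $yu$ are factors of $s$. An infinite word $s$ over $A$ is standard episturmian if it is closed under reversal (the reversal of every factor of $s$ is a factor of $s$) and every left special factor of $s$ is a prefix of $s$. Non-periodic means not of the form $u^\omega$ with $u$ a non-empty finite word. $\mathrm{Fact}^+s$ is the set of non-empty finite factors (contiguous blocks) of $s$. A factorization of $s$ is an expression $s=U_1U_2U_3\cdots$ with all $U_i$ non-empty finite words. $\mathcal P$ is the class of infinite words $s$ over finite alphabets for which there exist a finite set $C$ and a map (coloring) $c:\mathrm{Fact}^+s\to C$ such that for each factorization $s=U_1U_2U_3\cdots$ there exist $i,j\ge1$ with $c(U_i)\ne c(U_j)$. *)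

(* Defs.v *)
From mathcomp Require Import all_boot.
From mathcomp Require Import boolp classical_sets.

Set Implicit Arguments.
Unset Strict Implicit.
Unset Printing Implicit Defensive.

Local Open Scope classical_set_scope.

(* An infinite word over A is a function nat -> A, with letters numbered
   from 0; a finite word is a seq A. *)

(* The finite word s_i s_(i+1) ... s_(i+n-1). *)
Definition block (A : Type) (s : nat -> A) (i n : nat) : seq A :=
  mkseq (fun k => s (i + k)) n.

Definition is_factor (A : Type) (s : nat -> A) (u : seq A) : Prop :=
  exists i, u = block s i (size u).

Definition is_prefix (A : Type) (s : nat -> A) (u : seq A) : Prop :=
  u = block s 0 (size u).

Definition left_special (A : Type) (s : nat -> A) (u : seq A) : Prop :=
  exists x y : A, [/\ x <> y, is_factor s (x :: u) & is_factor s (y :: u)].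

Definition closed_under_reversal (A : Type) (s : nat -> A) : Prop :=
  forall u : seq A, is_factor s u -> is_factor s (rev u).

Definition standard_episturmian (A : Type) (s : nat -> A) : Prop :=
  closed_under_reversal s /\
  forall u : seq A, is_factor s u -> left_special s u -> is_prefix s u.

(* s = u^omega; for non-empty u the index i %% size u is always in range. *)
Definition is_omega_power (A : Type) (u : seq A) (s : nat -> A) : Prop :=
  forall i, onth u (i %% size u) = Some (s i).

(* Pure periodicity: s = u^omega from its very first letter on. *)
Definition periodic (A : Type) (s : nat -> A) : Prop :=
  exists u : seq A, u <> [::] /\ is_omega_power u s.

Definition nonempty_factors (A : Type) (s : nat -> A) : set (seq A) :=
  [set u | u <> [::] /\ is_factor s u].

(* s = U_0 U_1 U_2 ... : as the U_i are non-empty, the infinite product is the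
   unique infinite word having all the finite products as prefixes. *)
Definition is_factorization (A : Type) (s : nat -> A) (U : nat -> seq A) : Prop :=
  (forall i, U i <> [::]) /\ forall n, is_prefix s (flatten (mkseq U n)).

(* The coloring c is defined on the non-empty factors of s only, through the
   coercion from sets to types.  The words of a factorization of s are
   non-empty factors of s, so letting U take its values in that type does not
   restrict the factorizations under consideration. *)
Definition classP (A : finType) (s : nat -> A) : Prop :=
  exists (C : finType) (c : nonempty_factors s -> C),
    forall U : nat -> nonempty_factors s,
      is_factorization s (fun i => val (U i)) ->
      exists i j, c (U i) <> c (U j).

(* Main.v *)
Require Import Defs.
From mathcomp Require Import all_boot.
From mathcomp Require Import boolp.

Set Implicit Arguments.
Unset Strict Implicit.
Unset Printing Implicit Defensive.

(** Order the alphabet and compare infinite words lexicographically.  Since [s]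
    is not periodic, [u s <> s] for every non-empty [u], so [u] can be colored by
    whether [u s < s] or [u s > s].  If [s = U_0 U_1 ...] with [U_i s < s] for
    all [i], then prepending [U_0 ... U_(n-1)] shows that the words
    [U_0 ... U_n s] decrease with [n], from [U_0 s < s] on; they converge to
    [s], which is absurd.  The case [>] is the same for the converse order
    (argument of Wojcik and Zamboni). *)

(* Past the end of [u], [nth] returns its default value, a letter of [x]. *)
Definition prepend (A : Type) (u : seq A) (x : nat -> A) : nat -> A :=
  fun i => nth (x (i - size u)) u i.

Definition lex (A : Type) (r : rel A) (x y : nat -> A) : Prop :=
  exists n, (forall k, k < n -> x k = y k) /\ r (x n) (y n).

Section Prepend.
Variable A : Type.
Implicit Types (u v : seq A) (x : nat -> A).

Lemma prepend_lt u x i : i < size u -> prepend u x i = nth (x 0) u i.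
Proof. by move=> iu; apply: set_nth_default. Qed.

Lemma prepend_addl u x i : prepend u x (size u + i) = x i.
Proof. by rewrite /prepend nth_default ?leq_addr // addKn. Qed.

Lemma prepend_cat u v x : prepend (u ++ v) x = prepend u (prepend v x).
Proof.
apply/funext => i; rewrite /prepend nth_cat size_cat subnDA.
case: ltnP => iu; first exact: set_nth_default.
by rewrite [RHS]nth_default.
Qed.

Lemma prepend_prefix u x i : is_prefix x u -> i < size u -> prepend u x i = x i.
Proof. by move=> pu iu; rewrite prepend_lt // pu nth_mkseq. Qed.

(** Iterating [x = u x] gives [x = u^q x] for every [q], so the letter of [x] at [i] is that of [u]
    at [i] modulo the length of [u]. *)
Lemma prepend_fixed_periodic u x : u <> [::] -> prepend u x = x -> periodic x.
Proof.
move=> u0 ux; exists u; split=> // i.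
have u_gt0 : 0 < size u by case: u u0 {ux}.
have xE j q : x (q * size u + j) = x j.
  by elim: q => // q IH; rewrite mulSn -addnA -[in LHS]ux prepend_addl.
rewrite onthE (nth_map (x 0)) ?ltn_mod // [in RHS](divn_eq i (size u)) xE.
by rewrite -[in RHS]ux prepend_lt // ltn_mod.
Qed.

End Prepend.

Section Lex.
Variables (A : Type) (r : rel A).
Hypotheses (r_irr : irreflexive r) (r_trans : transitive r).

Lemma lex_irr x : ~ lex r x x.
Proof. by case=> n [_]; rewrite r_irr. Qed.

Lemma lex_trans y x z : lex r x y -> lex r y z -> lex r x z.
Proof.
(* The earlier of the two first differences decides. *)
case=> m [xy rxy] [n [yz ryz]]; exists (minn m n); split.
  by move=> k; rewrite leq_min => /andP[km kn]; rewrite xy // yz.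
case: (ltngtP m n) => [mn|nm|mn].
- by rewrite -yz.
- by rewrite xy.
- by rewrite -mn in ryz; apply: r_trans ryz.
Qed.

Lemma lex_prepend u x y : lex r x y -> lex r (prepend u x) (prepend u y).
Proof.
case=> n [xy rxy]; exists (size u + n); rewrite !prepend_addl; split=> // k kn.
case: (ltnP k (size u)) => ku; first exact: set_nth_default.
by rewrite -(subnKC ku) !prepend_addl xy // ltn_subLR.
Qed.

Lemma leq_size_factors (U : nat -> seq A) n :
  (forall i, U i <> [::]) -> n <= size (flatten (mkseq U n)).
Proof.
move=> U0; elim: n => // n IH.
rewrite mkseqS flatten_rcons size_cat -addn1 leq_add //.
by case: (U n) (U0 n).
Qed.

(** Convergence is needed only up to the position [m] that decides [U_0 s < s]: once [U_0 ... U_n s]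
    agrees with [s] through [m], it exceeds [U_0 s], although the sequence never rises above its
    first term. *)
Lemma no_decreasing_factorization s (U : nat -> seq A) :
  is_factorization s U -> ~ forall i, lex r (prepend (U i) s) s.
Proof.
move=> [U0 Upre] Ulex; pose W n := flatten (mkseq U n).
have W_le n : prepend (W n.+1) s = prepend (U 0) s \/
              lex r (prepend (W n.+1) s) (prepend (U 0) s).
  elim: n => [|n IH]; first by left; rewrite /W /= cats0.
  have lt_W : lex r (prepend (W n.+2) s) (prepend (W n.+1) s).
    (* Prepend [U_0 ... U_n] to [U_(n+1) s < s]. *)
    rewrite {1}/W mkseqS flatten_rcons prepend_cat.
    exact: lex_prepend.
  by right; case: IH => [<- //|]; apply: lex_trans.
have [m [eqm rm]] := Ulex 0.
(* The [m + 1] non-empty words [U_0, ..., U_m] form a prefix of [s] longer than [m]. *)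
have WE k : k <= m -> prepend (W m.+1) s k = s k.
  move=> km; apply: prepend_prefix; first exact: Upre.
  exact: leq_trans (leq_size_factors _ U0).
have lt_W : lex r (prepend (U 0) s) (prepend (W m.+1) s).
  exists m; rewrite WE //; split=> // k km.
  by rewrite WE ?eqm // ltnW.
case: (W_le m) => [eqW|gtW]; first by rewrite eqW in lt_W; apply: lex_irr lt_W.
exact: lex_irr (lex_trans lt_W gtW).
Qed.

Lemma lex_total x y : (forall a b, a <> b -> r a b \/ r b a) ->
  x <> y -> lex r x y \/ lex r y x.
Proof.
move=> r_total neq.
have ex : exists n, `[< x n <> y n >].
  apply: contrapT => nex; apply: neq; apply/funext => n.
  by apply: contrapT => xyn; apply: nex; exists n; apply/asboolP.
case: (ex_minnP ex) => n /asboolP xyn min_n.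
have eqn k : k < n -> x k = y k.
  move=> kn; apply: contrapT => xyk.
  by have := min_n k (asboolT xyk); rewrite leqNgt kn.
case: (r_total _ _ xyn) => rn; [left|right]; exists n; split=> // k kn.
by rewrite eqn.
Qed.

End Lex.

Theorem mainTheorem10 (A : finType) (hA : 0 < #|A|) (s : nat -> A)
    (hs : standard_episturmian s) (hnp : ~ periodic s) : classP s.
Proof.
pose r : rel A := fun a b => enum_rank a < enum_rank b.
pose r' : rel A := fun a b => r b a.
have r_irr : irreflexive r by move=> a; apply: ltnn.
have r_trans : transitive r by move=> b a c; apply: ltn_trans.
have r'_trans : transitive r' by move=> b a c ab bc; apply: r_trans bc ab.
have r_total a b : a <> b -> r a b \/ r b a.
  move=> ab; apply/orP; rewrite /r -neq_ltn.
  by apply/eqP => /ord_inj/enum_rank_inj.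
have lex_conv x y : lex r x y -> lex r' y x.
  by case=> n [xy rn]; exists n; split=> // k kn; rewrite xy.
exists bool, (fun u => `[< lex r (prepend (val u) s) s >]) => U Ufact.
apply: contrapT => mono.
(* Without two different colors, every [U_i] has the color of [U_0]. *)
have {}mono i : `[< lex r (prepend (val (U i)) s) s >]
              = `[< lex r (prepend (val (U 0)) s) s >].
  by apply: contrapT => ne; apply: mono; exists i, 0.
have [lt0|nlt0] := boolP `[< lex r (prepend (val (U 0)) s) s >].
  apply: (no_decreasing_factorization r_irr r_trans Ufact) => i.
  by apply/asboolP; rewrite mono.
(* No [U_i s] is below [s], and none equals [s] by non-periodicity; hence all lie above [s], that
   is, below it for [r']. *)
apply: (no_decreasing_factorization (r := r') r_irr r'_trans Ufact) => i.
apply: lex_conv.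
have neq : prepend (val (U i)) s <> s.
  by move=> /prepend_fixed_periodic-/(_ (Ufact.1 i)).
case: (lex_total r_total neq) => // lti.
by case/negP: nlt0; rewrite -(mono i); apply/asboolP.
Qed.
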